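(* Let $(\mathcal C,\mathsf d_{\mathcal C})$ be the cone, with apex $\boldsymbol 0$, over a geodesic metric space $(\mathcal X,\mathsf d_{\mathcal X})$. Let $z_0=[x_0,r_0]\in\mathcal C\setminus\{\boldsymbol0\}$, $z_1=[x_1,r_1],z_2=[x_2,r_2]\in\mathcal C\setminus\{z_0\}$ with $0<\mathsf d_{\mathcal X}(x_0,x_i)<\pi$ for $i\in\{1,2\}$. Let $\boldsymbol x_{0i}\in\mathrm{Geod}(x_0,x_i)$ for $i=1,2$, and let $\boldsymbol z_{0i}$ be the corresponding geodesics in $\mathcal C$ joining $z_0$ to $z_i$. Put $\phi_{0i}=\mathsf d_{\mathcal X}(x_0,x_i)$. Then $$\mathrm{AP}(\boldsymbol z_{01},\boldsymbol z_{02})=\frac{(r_0-r_1\cos\phi_{01})(r_0-r_2\cos\phi_{02})}{\mathsf d_{\mathcal C}(z_0,z_1)\mathsf d_{\mathcal C}(z_0,z_2)}+\frac{r_1r_2\sin(\phi_{01})\sin(\phi_{02})}{\mathsf d_{\mathcal C}(z_0,z_1)\mathsf d_{\mathcal C}(z_0,z_2)}\,\mathrm{AP}(\boldsymbol x_{01},\boldsymbol x_{02}),$$ where the operations between sets and real numbers are elementwise. More specifically, $$\cos\big(\angle_{\mathrm{up}}(\boldsymbol z_{01},\boldsymbol z_{02})\big)=\frac{(r_0-r_1\cos\phi_{01})(r_0-r_2\cos\phi_{02})+r_1r_2\sin(\phi_{01})\sin(\phi_{02})\cos\big(\angle_{\mathrm{up}}(\boldsymbol x_{01},\boldsymbol x_{02})\big)}{\mathsf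 d_{\mathcal C}(z_0,z_1)\mathsf d_{\mathcal C}(z_0,z_2)},$$ and, when $r_1,r_2>0$, $$\cos\big(\angle_{\mathrm{up}}(\boldsymbol x_{01},\boldsymbol x_{02})\big)=\frac{\mathsf d_{\mathcal C}(z_0,z_1)\mathsf d_{\mathcal C}(z_0,z_2)\cos\big(\angle_{\mathrm{up}}(\boldsymbol z_{01},\boldsymbol z_{02})\big)}{r_1r_2\sin(\phi_{01})\sin(\phi_{02})}-\frac{(r_0-r_1\cos\phi_{01})(r_0-r_2\cos\phi_{02})}{r_1r_2\sin(\phi_{01})\sin(\phi_{02})}.$$ Furthermore, when $x_0=x_1$ or $x_0=x_2$, the formula for $\cos(\angle_{\mathrm{up}}(\boldsymbol z_{01},\boldsymbol z_{02}))$ holds with the second summand of the numerator (the one containing $\sin(\phi_{01})\sin(\phi_{02})$) equal to zero.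
   Context: The cone $\mathcal C$ over $(\mathcal X,\mathsf d_{\mathcal X})$ is the quotient of $\mathcal X\times[0,\infty)$ obtained by identifying all points of $\mathcal X\times\{0\}$ with one point $\boldsymbol 0$; $[x,r]$ is the class of $(x,r)$, and $\mathsf d_{\mathcal C}^2([x_0,r_0],[x_1,r_1])=r_0^2+r_1^2-2r_0r_1\cos(\min\{\pi,\mathsf d_{\mathcal X}(x_0,x_1)\})$. $\mathrm{Geod}(x_0,x_1)$ is the set of constant-speed geodesics $[0,1]\to\mathcal X$ from $x_0$ to $x_1$. Corresponding geodesics: for $\boldsymbol x_{0i}\in\mathrm{Geod}(x_0,x_i)$ with $0<\phi_{0i}<\pi$, the corresponding geodesic in $\mathcal C$ from $[x_0,r_0]$ to $[x_i,r_i]$ is $\boldsymbol z_{0i}(t)=[\boldsymbol x_{0i}(\zeta_{0i}(t)),\boldsymbol r_{0i}(t)]$ with $\boldsymbol r_{0i}^2(t)=(1-t)^2r_0^2+t^2r_i^2+2t(1-t)r_0r_i\cos\phi_{0i}$ and $\zeta_{0i}(t)=\frac1{\phi_{0i}}\arccos\Big(\frac{(1-t)r_0+t\,r_i\cos\phi_{0i}}{\boldsymbol r_{0i}(t)}\Big)$ (the apex where $\boldsymbol r_{0i}(t)=0$); if $x_0=x_i$ it is $t\mapsto[x_0,(1-t)r_0+tr_i]$. For two non-trivial geodesics $\boldsymbol y_{01},\boldsymbol y_{02}$ in a metric space $(Y,\mathsf d)$ starting at the same point $y_0$, let $a_0(y_0;y_1,y_2)=\frac{\mathsf d^2(y_0,y_1)+\mathsf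 d^2(y_0,y_2)-\mathsf d^2(y_1,y_2)}{2\mathsf d(y_0,y_1)\mathsf d(y_0,y_2)}$. Then $\mathrm{AP}(\boldsymbol y_{01},\boldsymbol y_{02})$ is the set of $c\in[-1,1]$ for which there are sequences $0<s_k,t_k\to0$ with $a_0(y_0;\boldsymbol y_{01}(t_k),\boldsymbol y_{02}(s_k))\to c$, and the upper angle is $\angle_{\mathrm{up}}(\boldsymbol y_{01},\boldsymbol y_{02})=\limsup_{s,t\downarrow0}\arccos a_0(y_0;\boldsymbol y_{01}(s),\boldsymbol y_{02}(t))=\arccos(\inf\mathrm{AP}(\boldsymbol y_{01},\boldsymbol y_{02}))\in[0,\pi]$. *)

(* Defs.v *)
From HB Require Import structures.
From mathcomp Require Import all_boot all_order all_algebra.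
From mathcomp Require Import generic_quotient.
From mathcomp Require Import all_classical all_reals all_analysis.
From mathcomp Require Import ring lra.

Set Implicit Arguments.
Unset Strict Implicit.
Unset Printing Implicit Defensive.

Import Order.TTheory GRing.Theory Num.Theory.
Import numFieldNormedType.Exports.
Local Open Scope classical_set_scope.
Local Open Scope ring_scope.
Local Open Scope quotient_scope.

(* Curves [0,1] -> Y are represented by functions R -> Y, whose values outside
   [0,1] play no role. *)

Section Geodesics.
Context {R : realType} {Y : metricType R}.
Implicit Types (y : Y) (g : R -> Y).

Definition Geod y0 y1 : set (R -> Y) :=
  [set g | [/\ g 0 = y0, g 1 = y1 &
    forall s t : R, 0 <= s <= 1 -> 0 <= t <= 1 ->
      mdist (g s) (g t) = `|s - t| * mdist y0 y1]].

Definition a0 y0 y1 y2 : R :=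
  (mdist y0 y1 ^+ 2 + mdist y0 y2 ^+ 2 - mdist y1 y2 ^+ 2)
    / (2 * mdist y0 y1 * mdist y0 y2).

(* For curves with the same starting point, which is read off as [g1 0]. *)
Definition AP g1 g2 : set R :=
  [set c : R | -1 <= c <= 1 /\
    exists s t : nat -> R,
      [/\ (forall k, 0 < s k <= 1) /\ (forall k, 0 < t k <= 1),
          s k @[k --> \oo] --> (0 : R), t k @[k --> \oo] --> (0 : R) &
          a0 (g1 0) (g1 (t k)) (g2 (s k)) @[k --> \oo] --> c]].

(* The upper limit lives in the extended reals; it belongs to [0, pi] for
   non-trivial geodesics, since a0 then takes its values in [-1, 1]. *)
Definition angle_up g1 g2 : R :=
  fine (limf_esup
    (fun st : R * R => (acos (a0 (g1 0) (g1 st.1) (g2 st.2)))%:E)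
    (filter_prod (0 : R)^'+ (0 : R)^'+)).

End Geodesics.

Definition geodesic_space (R : realType) (X : metricType R) : Prop :=
  forall x y : X, exists g : R -> X, Geod x y g.

Section Cone.
Context {R : realType} (X : metricType R).

Definition cone_eqv (p q : X * {nonneg R}) : bool :=
  (p == q) || (p.2%:num == 0) && (q.2%:num == 0).

Lemma cone_eqv_refl : reflexive cone_eqv.
Proof. by move=> p; rewrite /cone_eqv eqxx. Qed.

Lemma cone_eqv_sym : symmetric cone_eqv.
Proof. by move=> p q; rewrite /cone_eqv eq_sym andbC. Qed.

Lemma cone_eqv_trans : transitive cone_eqv.
Proof.
move=> q p s /orP[/eqP->//|/andP[p0 q0]] /orP[/eqP<-|/andP[_ s0]].
  by rewrite /cone_eqv p0 q0 orbT.
by rewrite /cone_eqv p0 s0 orbT.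
Qed.

Canonical cone_equiv :=
  EquivRel cone_eqv cone_eqv_refl cone_eqv_sym cone_eqv_trans.

Definition cone : Type := {eq_quot cone_equiv}.

HB.instance Definition _ := Choice.on cone.
HB.instance Definition _ := EqQuotient.on cone.

End Cone.

Section ConeMetric.
Context {R : realType} {X : metricType R}.
Implicit Types (x : X) (r : {nonneg R}).

Definition cpt x r : cone X := \pi_(cone X) (x, r).

Definition is_apex (z : cone X) : Prop := exists x, z = cpt x 0%:nng.

Definition cone_pdist (p q : X * {nonneg R}) : R :=
  Num.sqrt (p.2%:num ^+ 2 + q.2%:num ^+ 2
    - 2 * p.2%:num * q.2%:num * cos (Num.min pi (mdist p.1 q.1))).

Definition cone_dist (z w : cone X) : R := cone_pdist (repr z) (repr w).

Lemma cpt_eq x r y s :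
  (cpt x r == cpt y s) =
  ((x, r) == (y, s)) || (r%:num == 0) && (s%:num == 0).
Proof. by rewrite /cpt eqmodE. Qed.

Lemma cone_pdistC p q : cone_pdist p q = cone_pdist q p.
Proof.
rewrite /cone_pdist metric_sym; congr Num.sqrt.
by rewrite [_ ^+ 2 + _]addrC; congr (_ - _ * _); ring.
Qed.

Lemma cone_pdist_eqv p p' q :
  cone_eqv p p' -> cone_pdist p q = cone_pdist p' q.
Proof.
move=> /orP[/eqP->//|/andP[/eqP p0 /eqP p'0]].
by rewrite /cone_pdist p0 p'0 !(mulr0, mul0r).
Qed.

Lemma cone_distE x0 r0 x1 r1 :
  cone_dist (cpt x0 r0) (cpt x1 r1) =
  Num.sqrt (r0%:num ^+ 2 + r1%:num ^+ 2
    - 2 * r0%:num * r1%:num * cos (Num.min pi (mdist x0 x1))).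
Proof.
have E p : cone_eqv (repr (\pi_(cone X) p)) p.
  by have /eqP := reprK (\pi_(cone X) p); rewrite eqmodE.
rewrite /cone_dist (cone_pdist_eqv _ (E (x0, r0))) cone_pdistC.
by rewrite (cone_pdist_eqv _ (E (x1, r1))) cone_pdistC.
Qed.

Let csq (r s t : R) : R := r ^+ 2 + s ^+ 2 - 2 * r * s * cos t.

Let minkowski (x y u v : R) :
  Num.sqrt ((x + u) ^+ 2 + (y + v) ^+ 2) <=
  Num.sqrt (x ^+ 2 + y ^+ 2) + Num.sqrt (u ^+ 2 + v ^+ 2).
Proof.
have h1 : 0 <= x ^+ 2 + y ^+ 2 by rewrite addr_ge0 ?sqr_ge0.
have h2 : 0 <= u ^+ 2 + v ^+ 2 by rewrite addr_ge0 ?sqr_ge0.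
set a := Num.sqrt (x ^+ 2 + y ^+ 2); set b := Num.sqrt (u ^+ 2 + v ^+ 2).
have a0 : 0 <= a by apply: sqrtr_ge0.
have b0 : 0 <= b by apply: sqrtr_ge0.
have aE : a ^+ 2 = x ^+ 2 + y ^+ 2 by rewrite sqr_sqrtr.
have bE : b ^+ 2 = u ^+ 2 + v ^+ 2 by rewrite sqr_sqrtr.
rewrite -[leRHS]ger0_norm ?addr_ge0// -sqrtr_sqr; apply: ler_wsqrtr.
have cs : x * u + y * v <= a * b.
  apply: (le_trans (ler_norm _)).
  rewrite -[leRHS]ger0_norm ?mulr_ge0// -!sqrtr_sqr; apply: ler_wsqrtr.
  rewrite exprMn aE bE.
  have := sqr_ge0 (x * v - y * u); nra.
by rewrite (sqrrD a b) aE bE; lra.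
Qed.

Let planar_triangle (r0 r1 r2 a b : R) :
  Num.sqrt (csq r0 r2 (a + b)) <=
  Num.sqrt (csq r0 r1 a) + Num.sqrt (csq r1 r2 b).
Proof.
have ca := cos2Dsin2 a; have cb := cos2Dsin2 b.
have := minkowski (r0 * cos a - r1) (r0 * sin a)
  (r1 - r2 * cos b) (r2 * sin b).
have -> : (r0 * cos a - r1 + (r1 - r2 * cos b)) ^+ 2
    + (r0 * sin a + r2 * sin b) ^+ 2 = csq r0 r2 (a + b).
  transitivity (r0 ^+ 2 * (cos a ^+ 2 + sin a ^+ 2)
    + r2 ^+ 2 * (cos b ^+ 2 + sin b ^+ 2)
    - 2 * r0 * r2 * (cos a * cos b - sin a * sin b)); first by ring.
  by rewrite ca cb !mulr1 -cosD.
have -> : (r0 * cos a - r1) ^+ 2 + (r0 * sin a) ^+ 2 = csq r0 r1 a.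
  transitivity (r0 ^+ 2 * (cos a ^+ 2 + sin a ^+ 2)
    + r1 ^+ 2 - 2 * r0 * r1 * cos a); first by ring.
  by rewrite ca mulr1.
have -> // : (r1 - r2 * cos b) ^+ 2 + (r2 * sin b) ^+ 2 = csq r1 r2 b.
transitivity (r1 ^+ 2 + r2 ^+ 2 * (cos b ^+ 2 + sin b ^+ 2)
  - 2 * r1 * r2 * cos b); first by ring.
by rewrite cb mulr1.
Qed.

Let csq_le (r s t t' : R) : 0 <= r -> 0 <= s -> cos t' <= cos t ->
  Num.sqrt (csq r s t) <= Num.sqrt (csq r s t').
Proof.
move=> r0 s0 tt'; apply: ler_wsqrtr; rewrite /csq lerD2l lerN2.
by rewrite ler_wpM2l// !mulr_ge0.
Qed.

Let cos_nincr (s t : R) : 0 <= s -> s <= t -> t <= pi -> cos t <= cos s.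
Proof.
move=> s0 st tpi.
have [->//|nst] := eqVneq s t.
by apply/ltW; rewrite ltr_cos ?in_itv/= ?s0 ?tpi ?(le_trans st)
  ?(le_trans s0)//= lt_neqAle nst.
Qed.

Let cone_triangle (r0 r1 r2 a b c : R) :
  0 <= r0 -> 0 <= r1 -> 0 <= r2 -> 0 <= a <= pi -> 0 <= b <= pi ->
  0 <= c <= pi -> c <= a + b ->
  Num.sqrt (csq r0 r2 c) <= Num.sqrt (csq r0 r1 a) + Num.sqrt (csq r1 r2 b).
Proof.
move=> r00 r10 r20 /andP[a0 api] /andP[b0 bpi] /andP[c0 cpi] cab.
have [abpi|piab] := leP (a + b) pi.
  apply: le_trans (planar_triangle _ _ _ _ _).
  by apply: csq_le => //; apply: cos_nincr.
apply: (@le_trans _ _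
    (Num.sqrt (csq r0 r1 a) + Num.sqrt (csq r1 r2 (pi - a)))).
  apply: le_trans (planar_triangle _ _ _ _ _).
  by apply: csq_le => //; rewrite subrKC cospi cos_geN1.
rewrite lerD2l; apply: csq_le => //.
by apply: cos_nincr => //; lra.
Qed.

Let cone_ind (P : cone X -> Prop) : (forall x r, P (cpt x r)) -> forall z, P z.
Proof. by move=> h z; rewrite -(reprK z); case: (repr z) => x r; exact: h. Qed.

Let minpi_bound (t : R) : 0 <= t -> 0 <= Num.min pi t <= pi.
Proof. by move=> t0; rewrite le_min pi_ge0 t0 ge_min lexx. Qed.

Lemma cone_distxx z : cone_dist z z = 0.
Proof.
elim/cone_ind: z => x r.
rewrite cone_distE mdistxx min_r ?pi_ge0// cos0.
by rewrite -[RHS]sqrtr0; congr Num.sqrt; ring.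
Qed.

Lemma cone_dist_sym z w : cone_dist z w = cone_dist w z.
Proof. exact: cone_pdistC. Qed.

Lemma cone_dist_positivity z w : cone_dist z w = 0 -> z = w.
Proof.
elim/cone_ind: z => x r; elim/cone_ind: w => y s.
rewrite cone_distE => /eqP; rewrite sqrtr_eq0 => h.
set t := Num.min pi _ in h.
have r0 : 0 <= r%:num by []; have s0 : 0 <= s%:num by [].
have c1 := cos_le1 t.
have hrs : r%:num = s%:num.
  apply/eqP; rewrite -subr_eq0 -sqrf_eq0 eq_le sqr_ge0 andbT.
  have : 0 <= r%:num * s%:num * (1 - cos t) by rewrite !mulr_ge0 ?subr_ge0.
  by rewrite sqrrB; lra.
apply/eqP; rewrite cpt_eq.
have [r0'|rn0] := eqVneq r%:num 0; first by rewrite -hrs r0' eqxx orbT.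
have rgt0 : 0 < r%:num by rewrite lt_neqAle eq_sym rn0.
have ct : cos t = 1.
  apply/eqP; rewrite eq_le c1 -subr_le0 -(@pmulr_rle0 _ (r%:num ^+ 2)) ?exprn_gt0//.
  by rewrite -hrs in h; nra.
have tb : 0 <= t <= pi := minpi_bound (mdist_ge0 x y).
have t0 : t = 0.
  have := @cosK R t; rewrite in_itv/= tb => /(_ isT) <-; rewrite ct.
  by rewrite -(@cos0 R) cosK// in_itv/= lexx pi_ge0.
have xy : x = y.
  apply: mdist_positivity; move: t0; rewrite /t minElt; case: ifP => // _ p0.
  by have := @pi_gt0 R; rewrite p0 ltxx.
by apply/orP; left; rewrite xy; apply/eqP; congr pair; apply/val_inj.
Qed.

Lemma cone_dist_triangle w z u :
  cone_dist z u <= cone_dist z w + cone_dist w u.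
Proof.
elim/cone_ind: z => x r; elim/cone_ind: w => y s; elim/cone_ind: u => v q.
rewrite !cone_distE; apply: cone_triangle => //; try exact: minpi_bound (mdist_ge0 _ _).
have d1 := mdist_ge0 x y; have d2 := mdist_ge0 y v.
have := metric_triangle x y v; have := @pi_ge0 R.
rewrite !minElt.
case: (ltP pi (mdist x v)) => h1; case: (ltP pi (mdist x y)) => h2;
  case: (ltP pi (mdist y v)) => h3; move=> ? ?; lra.
Qed.

HB.instance Definition _ := isMetric.Build R (cone X)
  cone_distxx cone_dist_positivity cone_dist_sym cone_dist_triangle.

End ConeMetric.

(* The geodesic of the cone from [x0, r0] to [xi, ri] that corresponds to the
   geodesic x0i of X from x0 to xi. Where the radius vanishes, the value is the
   apex whatever zeta is. The norm in the case x0 = xi only serves to produce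
   a nonnegative radius; it has no effect for t in [0,1]. *)
Section ConeGeodesic.
Context {R : realType} {X : metricType R}.
Variables (x0 xi : X) (r0 ri : {nonneg R}) (x0i : R -> X).

Let phi : R := mdist x0 xi.

Definition cgeod_radius (t : R) : {nonneg R} :=
  (Num.sqrt ((1 - t) ^+ 2 * r0%:num ^+ 2 + t ^+ 2 * ri%:num ^+ 2
    + 2 * t * (1 - t) * r0%:num * ri%:num * cos phi))%:nng.

Definition cgeod_zeta (t : R) : R :=
  phi^-1 * acos (((1 - t) * r0%:num + t * ri%:num * cos phi)
                  / (cgeod_radius t)%:num).

Definition cgeod (t : R) : cone X :=
  if x0 == xi then cpt x0 `|(1 - t) * r0%:num + t * ri%:num|%:nng
  else cpt (x0i (cgeod_zeta t)) (cgeod_radius t).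

End ConeGeodesic.

(* Main.v *)
Require Import Defs.
From mathcomp Require Import all_boot all_order all_algebra.
From mathcomp Require Import all_classical all_reals all_analysis.
From mathcomp Require Import ring lra.

(* In the plane, the cone geodesic from [x0, r0] to [xi, ri] unrolls to the
   chord (r0 - t A, t B), with A = r0 - ri cos phi and B = ri sin phi. Writing
   its points in polar coordinates (rho, th), the comparison cosine in the cone
   satisfies the exact identity
     a0 = (A1 A2 + rho1 rho2 (cos D - cos th1 cos th2) / (s t)) / (d01 d02),
   where D is the distance in X of the two projected points. Since
   s B1 = rho1 sin th1 and t B2 = rho2 sin th2, the last term is B1 B2 times
   the spherical comparison cosine of a triangle with sides th1, th2, D, which
   differs from the Euclidean one, the comparison cosine in X, by
   O(th1 + th2). As zeta is an invertible change of parameter near 0, limit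
   points and lower limits of a0 correspond under the affine map
   c |-> (P + Q c) / (d01 d02). *)

Set Implicit Arguments.
Unset Strict Implicit.
Unset Printing Implicit Defensive.

Import Order.TTheory GRing.Theory Num.Theory.
Import numFieldNormedType.Exports.
Local Open Scope classical_set_scope.
Local Open Scope ring_scope.

(** * Bounds for sine and cosine; spherical against Euclidean angles *)

Section Trigonometry.
Context {R : realType}.
Implicit Types a b d x y e : R.

Lemma cosB_le x y : x <= y -> cos x - cos y <= y - x.
Proof.
move=> xy; have [c _ h] := MVT_segment xy (fun z _ => is_derive_cos z)
  (continuous_subspaceT (@continuous_cos R)).
have := sin_geN1 c; have := sin_le1 c; nra.
Qed.

(** By the mean value theorem [sin x = x * cos c] with [c] in [0, x], and [1 - cos c <= c]. A
    relative error of order [x] is enough to compare angles in small triangles. *)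
Lemma sin_bounds x : 0 <= x -> x * (1 - x) <= sin x <= x.
Proof.
move=> x0; have [c] := MVT_segment x0 (fun z _ => is_derive_sin z)
  (continuous_subspaceT (@continuous_sin R)).
rewrite in_itv/= sin0 !subr0 => /andP[c0 cx] ->.
have := cosB_le c0; rewrite cos0 => h.
have := cos_le1 c; nra.
Qed.

Lemma sin_le_factor x e : 0 <= x <= e -> x * (1 - e) <= sin x <= x.
Proof.
move=> /andP[x0 xe]; have /andP[h ->] := sin_bounds x0.
by rewrite andbT; apply: le_trans h; rewrite ler_wpM2l// lerD2l lerN2.
Qed.

(* With p, q = (d +/- (a - b)) / 2, both sides are affine in a ratio of
   products: the left one is 1 - 2 (sin p sin q) / (sin a sin b), the right
   one is 1 - 2 (p q) / (a b). *)
Lemma spherical_euclidean_angle a b d e : 0 < a -> 0 < b ->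
  `|a - b| <= d <= a + b -> a + b <= e -> e <= 4^-1 ->
  `|(cos d - cos a * cos b) / (sin a * sin b)
    - (a ^+ 2 + b ^+ 2 - d ^+ 2) / (2 * a * b)| <= 8 * e.
Proof.
move=> a0 b0 /andP[abd dab] abe e4.
have e0 : 0 <= e by lra.
have /andP[sa1 sa2] : a * (1 - e) <= sin a <= a by apply: sin_le_factor; lra.
have /andP[sb1 sb2] : b * (1 - e) <= sin b <= b by apply: sin_le_factor; lra.
have := abd; rewrite ler_norml => /andP[d1 d2].
pose p := (d + (a - b)) / 2; pose q := (d - (a - b)) / 2.
have p0 : 0 <= p by rewrite /p; lra.
have q0 : 0 <= q by rewrite /q; lra.
have /andP[sp1 sp2] : p * (1 - e) <= sin p <= p.
  by apply: sin_le_factor; rewrite p0/= /p; lra.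
have /andP[sq1 sq2] : q * (1 - e) <= sin q <= q.
  by apply: sin_le_factor; rewrite q0/= /q; lra.
have sa0 : 0 < sin a by apply: lt_le_trans sa1; rewrite mulr_gt0//; lra.
have sb0 : 0 < sin b by apply: lt_le_trans sb1; rewrite mulr_gt0//; lra.
(* This is [cos (p - q) - cos (p + q) = 2 * (sin p * sin q)], with [p - q = a - b] and
   [p + q = d]. *)
have cosE : cos d - cos a * cos b = sin a * sin b - 2 * (sin p * sin q).
  have -> : d = p + q by rewrite /p /q; lra.
  have := cosB a b; have -> : a - b = p - q by rewrite /p /q; lra.
  by rewrite cosB cosD; lra.
(* Here 4 p q = d^2 - (a - b)^2, and [d <= a + b]. *)
have pqab : p * q <= a * b by rewrite /p /q; nra.
have pq0 : 0 <= p * q by rewrite mulr_ge0.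
have ab0 : 0 < a * b by rewrite mulr_gt0.
have s0 : 0 < sin a * sin b by rewrite mulr_gt0.
have -> : (cos d - cos a * cos b) / (sin a * sin b)
    - (a ^+ 2 + b ^+ 2 - d ^+ 2) / (2 * a * b)
  = 2 * ((p * q) * (sin a * sin b) - (sin p * sin q) * (a * b))
      / ((a * b) * (sin a * sin b)).
  rewrite cosE /p /q; field.
  by rewrite !gt_eqF.
have lo (u v : R) : 0 <= u -> 0 <= v -> u * (1 - e) <= sin u <= u ->
    v * (1 - e) <= sin v <= v -> u * v * (1 - 2 * e) <= sin u * sin v <= u * v.
  move=> u0 v0 /andP[u1 u2] /andP[v1 v2].
  have u3 : 0 <= u * (1 - e) by rewrite mulr_ge0//; lra.
  have v3 : 0 <= v * (1 - e) by rewrite mulr_ge0//; lra.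
  apply/andP; split; last by apply: ler_pM => //; lra.
  apply: (@le_trans _ _ ((u * (1 - e)) * (v * (1 - e)))); last exact: ler_pM.
  have := mulr_ge0 (mulr_ge0 u0 v0) (sqr_ge0 e); nra.
have /andP[l1 l2] : a * b * (1 - 2 * e) <= sin a * sin b <= a * b.
  by apply: lo; rewrite ?sa1 ?sb1//; apply: ltW.
have /andP[l3 l4] : p * q * (1 - 2 * e) <= sin p * sin q <= p * q.
  by apply: lo; rewrite ?sp1 ?sq1.
rewrite normrM normfV [X in _ / X]gtr0_norm ?mulr_gt0// ler_pdivrMr ?mulr_gt0//.
have half : a * b / 2 <= sin a * sin b.
  by apply: le_trans l1; rewrite ler_pM2l//; lra.
move: (sin a * sin b) (sin p * sin q) (a * b) (p * q) l1 l2 l3 l4 half ab0 pq0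
  pqab => S T A P l1 l2 l3 l4 half A0 P0 PA.
(* The numerator is at most 4 e P A in absolute value; [P <= A] and [A <= 2 * S] then give the
   constant 8. *)
have AA : 4 * e * (A * A) <= 8 * e * (A * S).
  have := ler_wpM2l (mulr_ge0 e0 (ltW A0)) half; lra.
have PAA := ler_wpM2l (mulr_ge0 e0 (ltW A0)) PA.
rewrite ler_norml; apply/andP; split.
  have h1 := ler_wpM2l P0 l1; have h2 := ler_wpM2l (ltW A0) l4; lra.
have h1 := ler_wpM2l P0 l2; have h2 := ler_wpM2l (ltW A0) l3; lra.
Qed.

End Trigonometry.

(** * Limit points and lower limits as two parameters decrease to 0 *)

Section OneSidedLimits.
Context {R : realType}.
Implicit Types (f g : R -> R -> R) (c l : R) (z : R -> R).

(** The limit points that [AP] collects, in a form without sequences that suits changes of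
    parameter. *)
Definition cluster0 f c := forall e d, 0 < e -> 0 < d ->
  exists s t, [/\ 0 < s < d, 0 < t < d & `|f s t - c| < e].

(** The lower limit as a relation with a real number, which keeps extended reals out of the changes
    of parameter. *)
Definition liminf0 f l :=
  (forall e, 0 < e -> exists2 d, 0 < d &
     forall s t, 0 < s < d -> 0 < t < d -> l - e < f s t) /\
  (forall e d, 0 < e -> 0 < d ->
     exists s t, [/\ 0 < s < d, 0 < t < d & f s t < l + e]).

Lemma liminf0_cluster f l : liminf0 f l -> cluster0 f l.
Proof.
move=> [lo hi] e d e0 d0; have [d' d'0 h] := lo e e0.
have [|s [t [/andP[s0 s1] /andP[t0 t1] st]]] := hi e (Num.min d d') e0.
  by rewrite lt_min d0.
move: s1 t1; rewrite !lt_min => /andP[sd sd'] /andP[td td'].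
exists s, t; rewrite s0 t0 sd td; split=> //.
by rewrite ltr_distl st h ?s0 ?t0.
Qed.

(** Equations between cosines of upper angles come from exhibiting both sides as lower limits of one
    function. *)
Lemma liminf0_unique f l l' : liminf0 f l -> liminf0 f l' -> l = l'.
Proof.
suff H l1 l2 : liminf0 f l1 -> liminf0 f l2 -> l1 <= l2.
  by move=> h h'; apply/eqP; rewrite eq_le !H.
move=> [lo _] [_ hi]; rewrite leNgt; apply/negP => l21.
have e0 : 0 < (l1 - l2) / 2 by lra.
have [d d0 h] := lo _ e0.
have [s [t [s0 t0 st]]] := hi _ _ e0 d0.
have := h s t s0 t0; lra.
Qed.

Lemma liminf0_cst f c :
  (exists2 d, 0 < d & forall s t, 0 < s < d -> 0 < t < d -> f s t = c) ->
  liminf0 f c.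
Proof.
move=> [d d0 h]; split=> [e e0|e d' e0 d'0].
  by exists d => // s t s0 t0; rewrite h// ltrBlDr ltrDl.
have m0 : 0 < Num.min d d' / 2 by rewrite divr_gt0// lt_min d0.
have md : Num.min d d' <= d by rewrite ge_min lexx.
have md' : Num.min d d' <= d' by rewrite ge_min lexx orbT.
move: (Num.min d d') m0 md md' => m m0 md md'.
exists (m / 2), (m / 2); have md2 : 0 < m / 2 < d by apply/andP; split; lra.
by rewrite (h _ _ md2 md2); split=> //; first apply/andP; try split; lra.
Qed.

Lemma cluster0_cst f c c' :
  (exists2 d, 0 < d & forall s t, 0 < s < d -> 0 < t < d -> f s t = c) ->
  cluster0 f c' -> c' = c.
Proof.
move=> [d d0 h] cl; apply/eqP; rewrite eq_sym -subr_eq0 -normr_le0 leNgt.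
apply/negP => cc'; have [s [t [s0 t0]]] := cl _ _ cc' d0.
by rewrite h// ltxx.
Qed.

Lemma cluster0_bounds f c :
  (forall s t, -1 <= f s t <= 1) -> cluster0 f c -> -1 <= c <= 1.
Proof.
move=> f1 cl; apply/andP; split; apply/ler_addgt0Pr => e e0.
  have [s [t [_ _]]] := cl _ _ e0 ltr01; have := f1 s t.
  by rewrite ltr_distl => /andP[? ?] /andP[? ?]; lra.
have [s [t [_ _]]] := cl _ _ e0 ltr01; have := f1 s t.
by rewrite ltr_distl => /andP[? ?] /andP[? ?]; lra.
Qed.

Lemma cvg_cluster0 f c (u v : nat -> R) :
  (forall k, 0 < u k) -> (forall k, 0 < v k) ->
  u k @[k --> \oo] --> (0 : R) -> v k @[k --> \oo] --> (0 : R) ->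
  f (u k) (v k) @[k --> \oo] --> c -> cluster0 f c.
Proof.
move=> u0 v0 /cvgr0Pnorm_lt cu /cvgr0Pnorm_lt cv /cvgrPdistC_lt cf e d e0 d0.
near \oo => k; exists (u k), (v k); rewrite u0 v0; split.
- rewrite /= (le_lt_trans (ler_norm _))//.
  by near: k; exact: cu.
- rewrite /= (le_lt_trans (ler_norm _))//.
  by near: k; exact: cv.
- by near: k; exact: cf.
Unshelve. all: by end_near. Qed.

Lemma cluster0_cvg f c : cluster0 f c ->
  exists u v : nat -> R,
    [/\ (forall k, 0 < u k <= 1) /\ (forall k, 0 < v k <= 1),
        u k @[k --> \oo] --> (0 : R), v k @[k --> \oo] --> (0 : R) &
        f (u k) (v k) @[k --> \oo] --> c].
Proof.
move=> cl.
have h0 (k : nat) : 0 < k.+1%:R^-1 :> R by rewrite invr_gt0 ltr0n.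
have h1 (k : nat) : k.+1%:R^-1 <= 1 :> R by rewrite invf_le1 ?ltr0n// ler1n.
have cvg0 (w : nat -> R) : (forall k, `|w k| <= k.+1%:R^-1) ->
    w k @[k --> \oo] --> (0 : R).
  move=> wk; apply: norm_cvg0; apply: (squeeze_cvgr _ (cvg_cst _) cvg_harmonic).
  by apply: nearW => k; rewrite normr_ge0/= wk.
(* Using 1/(k+1) for both tolerances lets one squeeze argument settle all three limits, and keeps
   the parameters at most 1. *)
have /choice[w hw] (k : nat) : exists p : R * R,
    [/\ 0 < p.1 < k.+1%:R^-1, 0 < p.2 < k.+1%:R^-1 &
        `|f p.1 p.2 - c| < k.+1%:R^-1].
  by have [s [t st]] := cl _ _ (h0 k) (h0 k); exists (s, t).
exists (fun k => (w k).1), (fun k => (w k).2); split.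
- split=> k; have [/andP[a b] /andP[a' b'] _] := hw k.
    by rewrite a (le_trans (ltW b)).
  by rewrite a' (le_trans (ltW b')).
- by apply: cvg0 => k; have [/andP[a b] _ _] := hw k; rewrite gtr0_norm// ltW.
- by apply: cvg0 => k; have [_ /andP[a b] _] := hw k; rewrite gtr0_norm// ltW.
- apply/subr_cvg0; apply: cvg0 => k.
  by have [_ _ /ltW] := hw k.
Qed.

(** Together with [near_box]: the squares at the corner 0 form a base of the filter that defines the
    upper angle. *)
Lemma box_near d : 0 < d ->
  filter_prod (0 : R)^'+ (0 : R)^'+
    [set st : R * R | 0 < st.1 < d /\ 0 < st.2 < d].
Proof.
move=> d0; have H : \forall s \near (0 : R)^'+, 0 < s < d.
  near=> s; apply/andP; split; near: s; first exact: nbhs_right_gt.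
  exact: nbhs_right_lt.
exists ([set s | 0 < s < d], [set s | 0 < s < d]) => //=.
Unshelve. all: by end_near. Qed.

Lemma near_box (A : set (R * R)) : filter_prod (0 : R)^'+ (0 : R)^'+ A ->
  exists2 d, 0 < d & forall s t, 0 < s < d -> 0 < t < d -> A (s, t).
Proof.
have H (U : set R) : (0 : R)^'+ U ->
    exists2 d, 0 < d & forall s, 0 < s < d -> U s.
  move=> /nbhs_right0P/nbhs_ballP[d /= d0 h]; exists d => //.
  move=> s /andP[s0 sd]; rewrite -[s]add0r; apply: h => //.
  by rewrite /ball/= sub0r normrN gtr0_norm.
move=> [[U V] /= [/H[d d0 hd] /H[d' d'0 hd']] UVA].
exists (Num.min d d') => [|s t]; first by rewrite lt_min d0.
rewrite !lt_min => /and3P[s0 sd _] /and3P[t0 _ td].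
by apply: UVA; split; [apply: hd; rewrite /= s0|apply: hd'; rewrite /= t0].
Qed.

(* [acos] is decreasing, so a lower limit becomes an upper limit. *)
Lemma liminf0_cos_limf_esup f : (forall s t, -1 <= f s t <= 1) ->
  liminf0 f (cos (fine (limf_esup
    (fun st : R * R => (acos (f st.1 st.2))%:E)
    (filter_prod (0 : R)^'+ (0 : R)^'+)))).
Proof.
move=> f1; set F := filter_prod _ _; set h := fun st : R * R => _.
have fK s t : f s t = cos (acos (f s t)) by rewrite acosK ?in_itv/=.
(* The bounds 0 and pi make the upper limit finite, so [fine] returns its value and not a
   default. *)
have L0 : (0 <= limf_esup h F)%E.
  apply: limf_esup_ge0 => [|st]; last by rewrite lee_fin acos_ge0.
  move=> /near_box[d d0 h0].
  have d2 : 0 < d / 2 < d by apply/andP; split; lra.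
  exact: (h0 _ _ d2 d2).
have Lpi : (limf_esup h F <= (pi : R)%:E)%E.
  apply: ge_ereal_inf; exists (ereal_sup (h @` [set: R * R])).
    by exists setT => //; apply: filterT.
  by apply: ge_ereal_sup => _ [st _ <-]; rewrite lee_fin acos_lepi.
have [r LE] : exists r, limf_esup h F = r%:E.
  exists (fine (limf_esup h F)); rewrite fineK// fin_numElt.
  by rewrite (lt_le_trans _ L0)// (le_lt_trans Lpi)// ltry.
have [r0 rpi] : 0 <= r /\ r <= pi by rewrite -!lee_fin -LE.
rewrite LE/=; split=> [e e0|e d e0 d0].
- have : (limf_esup h F < (r + e)%:E)%E by rewrite LE lte_fin ltrDl.
  move=> /ereal_inf_lt[_ [V FV <-] Vre].
  have [d d0 hd] := near_box FV; exists d => // s t s0 t0.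
  have : acos (f s t) < r + e.
    rewrite -lte_fin; apply: le_lt_trans Vre; apply: ereal_sup_ubound.
    by exists (s, t) => //; exact: hd.
  move=> xre; rewrite [ltRHS]fK; move: xre; set x := acos _ => xre.
  (* Above [r] the cosine drops by at most [x - r < e]; below [r] it is larger than [cos r] by
     monotonicity. *)
  have [rx|xr] := leP r x; first by have := cosB_le rx; lra.
  have : cos r <= cos x.
    by apply/ltW; rewrite ltr_cos// in_itv/= ?r0// acos_ge0 ?acos_lepi.
  lra.
- set B := [set st : R * R | 0 < st.1 < d /\ 0 < st.2 < d].
  (* The supremum over every square is at least the upper limit, so some point of [B] comes within
     [e] of [r]. *)
  have : ((r - e)%:E < ereal_sup (h @` B))%E.
    apply: (@lt_le_trans _ _ r%:E); first by rewrite lte_fin ltrBlDr ltrDl.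
    rewrite -LE; apply: ereal_inf_lbound.
    by exists B => //; exact: box_near.
  move=> /ereal_sup_gt[_ [[s t] /= [s0 t0] <-]]; rewrite lte_fin => rex.
  exists s, t; split=> //; rewrite [ltLHS]fK; move: rex; set x := acos _ => rex.
  have [xr|rx] := leP x r; first by have := cosB_le xr; lra.
  have : cos x <= cos r.
    by apply/ltW; rewrite ltr_cos// in_itv/= ?r0// acos_ge0 ?acos_lepi.
  lra.
Qed.

(** * Transfer of limit points and lower limits under an affine map and changes of parameter *)

Section Reparametrization.
Variables (f g : R -> R -> R) (z1 z2 : R -> R) (c0 c1 : R).
Hypothesis c1_gt0 : 0 < c1.
Hypothesis fg : forall e, 0 < e -> exists2 d, 0 < d &
  forall s t, 0 < s < d -> 0 < t < d ->
    `|g s t - (c0 + c1 * f (z1 s) (z2 t))| < e.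
(** Invertibility near 0 in a weak form: the second clause, surjectivity onto small values, stands
    in for a continuous inverse. *)
Definition repar0 z :=
  (forall e, 0 < e -> exists2 d, 0 < d & forall t, 0 < t < d -> 0 < z t < e) /\
  (forall d, 0 < d -> exists2 e, 0 < e &
     forall s, 0 < s < e -> exists2 t, 0 < t < d & z t = s).
Hypotheses (hz1 : repar0 z1) (hz2 : repar0 z2).

Lemma near_repar0 e d : 0 < e -> 0 < d ->
  exists2 d', 0 < d' & forall s t, 0 < s < d' -> 0 < t < d' ->
    [/\ 0 < z1 s < d, 0 < z2 t < d &
        `|g s t - (c0 + c1 * f (z1 s) (z2 t))| < e].
Proof.
move=> e0 d0; have [d1 d10 h1] := hz1.1 d d0; have [d2 d20 h2] := hz2.1 d d0.
have [d3 d30 h3] := fg e0.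
exists (Num.min d1 (Num.min d2 d3)) => [|s t]; first by rewrite !lt_min d10 d20.
rewrite !lt_min => /and4P[s0 sd1 sd2 sd3] /and4P[t0 td1 td2 td3].
by split; [apply: h1|apply: h2|apply: h3]; rewrite ?s0 ?t0.
Qed.

(** The surjectivity clause of [repar0] pulls parameters of [f] back to parameters of [g], so values
    that [f] takes near 0 are nearly found again in [g]. *)
Lemma frequently_repar0 e d : 0 < e -> 0 < d ->
  exists2 d', 0 < d' & forall s t, 0 < s < d' -> 0 < t < d' ->
    exists s' t', [/\ 0 < s' < d, 0 < t' < d &
        `|g s' t' - (c0 + c1 * f s t)| < e].
Proof.
move=> e0 d0; have [d3 d30 h3] := fg e0.
have m0 : 0 < Num.min d d3 by rewrite lt_min d0.
have [d1 d10 h1] := hz1.2 _ m0; have [d2 d20 h2] := hz2.2 _ m0.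
exists (Num.min d1 d2) => [|s t]; first by rewrite lt_min d10.
rewrite !lt_min => /and3P[s0 sd1 _] /and3P[t0 _ td2].
have [|s' s'd zs] := h1 s; first by rewrite s0.
have [|t' t'd zt] := h2 t; first by rewrite t0.
move: s'd t'd; rewrite !lt_min => /and3P[? ? ?] /and3P[? ? ?].
exists s', t'; split; [exact/andP|exact/andP|].
by rewrite -zs -zt; apply: h3; apply/andP.
Qed.

(** As [c1] is positive, the affine map is increasing and respects lower limits. Half of [e] pays
    for [fg], half for the error of [f] scaled by [c1]. *)
Lemma liminf0_repar l : liminf0 f l -> liminf0 g (c0 + c1 * l).
Proof.
move=> [lo hi]; split=> [e e0|e d e0 d0].
  have e1 : 0 < e / 2 / c1 by rewrite !divr_gt0.
  have [d d0 h] := lo _ e1.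
  have [|d' d'0 h'] := @near_repar0 (e / 2) d _ d0; first by rewrite divr_gt0.
  exists d' => // s t s0 t0; have [zs zt] := h' s t s0 t0.
  rewrite ltr_norml => /andP[+ _].
  have := h _ _ zs zt; rewrite ltrBlDr -(ltr_pM2l c1_gt0) mulrDr.
  by rewrite [c1 * (_ / c1)]mulrC divfK ?gt_eqF//; lra.
have e1 : 0 < e / 2 / c1 by rewrite !divr_gt0.
have [|d' d'0 h'] := @frequently_repar0 (e / 2) d _ d0; first by rewrite divr_gt0.
have [s [t [s0 t0]]] := hi _ _ e1 d'0; rewrite -(ltr_pM2l c1_gt0) mulrDr.
rewrite [c1 * (_ / c1)]mulrC divfK ?gt_eqF// => st.
have [s' [t' [s'0 t'0]]] := h' s t s0 t0.
rewrite ltr_norml => /andP[_ ?]; exists s', t'; split=> //; lra.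
Qed.

Lemma cluster0_repar c : cluster0 f c -> cluster0 g (c0 + c1 * c).
Proof.
move=> cl e d e0 d0; have e1 : 0 < e / 2 / c1 by rewrite !divr_gt0.
have [|d' d'0 h'] := @frequently_repar0 (e / 2) d _ d0; first by rewrite divr_gt0.
have [s [t [s0 t0]]] := cl _ _ e1 d'0; rewrite ltr_pdivlMr// => st.
have [s' [t' [s'0 t'0 st']]] := h' s t s0 t0.
exists s', t'; split=> //.
have -> : g s' t' - (c0 + c1 * c) =
  (g s' t' - (c0 + c1 * f s t)) + (f s t - c) * c1 by ring.
rewrite (le_lt_trans (ler_normD _ _))// normrM (gtr0_norm c1_gt0); lra.
Qed.

Lemma cluster0_repar_inv c : cluster0 g c -> cluster0 f ((c - c0) / c1).
Proof.
move=> cl e d e0 d0; have e1 : 0 < e * c1 / 2 by rewrite divr_gt0// mulr_gt0.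
have [d' d'0 h'] := near_repar0 e1 d0.
have [s [t [s0 t0 st]]] := cl _ _ e1 d'0.
have [zs zt st'] := h' s t s0 t0.
exists (z1 s), (z2 t); split=> //.
have -> : f (z1 s) (z2 t) - (c - c0) / c1 =
    ((g s t - c) - (g s t - (c0 + c1 * f (z1 s) (z2 t)))) / c1.
  by field; rewrite gt_eqF.
rewrite normrM normfV (gtr0_norm c1_gt0) ltr_pdivrMr//.
rewrite (le_lt_trans (ler_normB _ _))//; lra.
Qed.

End Reparametrization.
End OneSidedLimits.

(** * Angles in a metric space through one-sided limits *)

Section MetricAngles.
Context {R : realType} {Y : metricType R}.
Implicit Types (y : Y) (g : R -> Y).

Lemma a0_bounds y0 y1 y2 : -1 <= a0 y0 y1 y2 <= 1.
Proof.
have t1 := metric_triangle y0 y1 y2; have t2 := metric_triangle y1 y0 y2.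
have := metric_triangle y0 y2 y1; rewrite /a0 (metric_sym y2) => t3.
rewrite (metric_sym y1 y0) in t2.
move: (mdist_ge0 y0 y1) (mdist_ge0 y0 y2) (mdist_ge0 y1 y2) t1 t2 t3.
move: (mdist y0 y1) (mdist y0 y2) (mdist y1 y2) => a b d a0 b0 d0 t1 t2 t3.
(* If one of the two sides has length 0, the quotient is a division by 0, whose value is 0. *)
have := mulr_ge0 a0 b0; rewrite le_eqVlt => /predU1P[ab0|ab0].
  by rewrite -mulrA -ab0 mulr0 invr0 mulr0 lerN10 ler01.
have ab2 : 0 < 2 * a * b by rewrite -mulrA mulr_gt0.
rewrite ler_pdivlMr// ler_pdivrMr//; apply/andP; split; nra.
Qed.

Lemma APP g1 g2 c :
  AP g1 g2 c <-> cluster0 (fun s t => a0 (g1 0) (g1 s) (g2 t)) c.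
Proof.
split=> [[c1 [s [t [[s0 t0] cs ct cst]]]]|cl].
  (* In [AP] the sequence [t] runs along the first curve and [s] along the second, hence the
     swap. *)
  apply: (cvg_cluster0 _ _ ct cs cst) => k.
    by have /andP[] := t0 k.
  by have /andP[] := s0 k.
split; first by apply: cluster0_bounds cl => s t; exact: a0_bounds.
by have [s [t [[s0 t0] cs ct cst]]] := cluster0_cvg cl; exists t, s.
Qed.

Lemma cos_angle_up_liminf0 g1 g2 :
  liminf0 (fun s t => a0 (g1 0) (g1 s) (g2 t)) (cos (angle_up g1 g2)).
Proof.
exact: (@liminf0_cos_limf_esup _ (fun s t => a0 (g1 0) (g1 s) (g2 t))
  (fun _ _ => a0_bounds _ _ _)).
Qed.

(** Needed when the affine map is constant: its image of [AP] must then be a singleton and not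
    empty. *)
Lemma AP_neq0 g1 g2 : AP g1 g2 !=set0.
Proof.
by eexists; apply/APP/liminf0_cluster; exact: cos_angle_up_liminf0.
Qed.

End MetricAngles.

(* The segment t |-> (r0 - t A, t B) of the plane, with A = r0 - r cos phi and
   B = r sin phi, is the chord that unrolls the cone geodesic: in polar
   coordinates its radius and angle are [cgeod_radius t] and
   [phi * cgeod_zeta t]. *)
Section Chord.
Context {R : realType} {X : metricType R}.
Variables (x0 xi : X) (r0 ri : {nonneg R}).
Let phi : R := mdist x0 xi.
Let A : R := r0%:num - ri%:num * cos phi.
Let B : R := ri%:num * sin phi.
Hypotheses (r0_gt0 : 0 < r0%:num) (phi_bound : 0 < phi < pi).
Local Notation rho t := (cgeod_radius x0 xi r0 ri t)%:num.
Let zeta : R -> R := cgeod_zeta x0 xi r0 ri.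

Let phi0 : 0 < phi. Proof. by case/andP: phi_bound. Qed.
Let phipi : phi < pi. Proof. by case/andP: phi_bound. Qed.
Let sinphi : 0 < sin phi. Proof. exact: sin_gt0_pi. Qed.

Lemma cgeod_radiusE t : rho t = Num.sqrt ((r0%:num - t * A) ^+ 2 + (t * B) ^+ 2).
Proof.
rewrite /=; congr Num.sqrt; rewrite -/phi /A /B.
have := cos2Dsin2 phi; move: (cos phi) (sin phi) => c s cs.
have sE : s ^+ 2 = 1 - c ^+ 2 by rewrite -cs; ring.
by rewrite [in X in _ = _ + X]mulrA [X in _ = _ + X]exprMn sE; ring.
Qed.

Lemma sqr_cgeod_radius t : rho t ^+ 2 = (r0%:num - t * A) ^+ 2 + (t * B) ^+ 2.
Proof. by rewrite cgeod_radiusE sqr_sqrtr// addr_ge0// sqr_ge0. Qed.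

(** The chord avoids the origin: for [ri = 0] it is radial and gets there only at [t = 1]; otherwise
    its height [t * B] is positive once [t > 0]. *)
Lemma cgeod_radius_gt0 t : 0 <= t <= 1 -> t < 1 \/ 0 < ri%:num -> 0 < rho t.
Proof.
move=> /andP[t0 t1] tr; rewrite cgeod_radiusE sqrtr_gt0.
have [ri0|rin0] := eqVneq ri%:num 0.
  have t1' : t < 1 by case: tr => //; rewrite ri0 ltxx.
  rewrite ltr_wpDr ?sqr_ge0// exprn_gt0// /A ri0 mul0r subr0 subr_gt0.
  by rewrite gtr_pMl.
have B0 : 0 < B by rewrite mulr_gt0// lt_neqAle eq_sym rin0/=.
move: t0; rewrite le_eqVlt => /predU1P[<-|t0].
  by rewrite !mul0r subr0 expr0n addr0 exprn_gt0.
by rewrite ltr_wpDl ?sqr_ge0// exprn_gt0// mulr_gt0.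
Qed.

(** As [cos phi <= 1], the radius is at most (1 - t) r0 + t ri. The bound serves to show that small
    angles come from small [t]. *)
Lemma cgeod_radius_le t : 0 <= t <= 1 -> rho t <= r0%:num + ri%:num.
Proof.
move=> /andP[t0 t1]; rewrite -[leRHS]ger0_norm; last by rewrite addr_ge0.
rewrite -sqrtr_sqr /=; apply: ler_wsqrtr; rewrite -/phi.
have a0 : 0 <= r0%:num by []; have b0 : 0 <= ri%:num by [].
move: (r0%:num) (ri%:num) a0 b0 => a b a0 b0.
have c1 := cos_le1 phi; move: (cos phi) c1 => c c1.
apply: (@le_trans _ _ (((1 - t) * a + t * b) ^+ 2)).
  have t1' : 0 <= 1 - t by lra.
  have := mulr_ge0 (mulr_ge0 (mulr_ge0 t0 t1') a0) b0; nra.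
have ta : (1 - t) * a <= a by nra.
have tb : t * b <= b by nra.
by rewrite lerXn2r ?nnegrE; nra.
Qed.

Lemma cgeod_angle_polar t : 0 < rho t -> 0 <= t <= 1 ->
  [/\ rho t * cos (zeta t * phi) = r0%:num - t * A,
      rho t * sin (zeta t * phi) = t * B & 0 <= zeta t <= 1].
Proof.
move=> rho0 /andP[t0 t1].
have B0 : 0 <= B by rewrite mulr_ge0// ltW.
set u := r0%:num - t * A; have uE : u = (1 - t) * r0%:num + t * ri%:num * cos phi.
  by rewrite /u /A; ring.
have r2 := sqr_cgeod_radius t; rewrite -/u in r2.
have zE : zeta t * phi = acos (u / rho t).
  by rewrite /zeta /cgeod_zeta -/phi -uE mulrC mulrA divff ?mul1r// gt_eqF.
have ur : -1 <= u / rho t <= 1.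
  have : u ^+ 2 <= rho t ^+ 2 by rewrite r2 lerDl sqr_ge0.
  rewrite ler_pdivlMr// ler_pdivrMr// mul1r mulN1r -ler_norml.
  by move=> h; rewrite -[leRHS](ger0_norm (ltW rho0)) -!sqrtr_sqr; exact: ler_wsqrtr.
have th0 := acos_ge0 ur; have thpi := acos_lepi ur.
have cosE : rho t * cos (acos (u / rho t)) = u.
  by rewrite acosK ?in_itv//= mulrC divfK// gt_eqF.
(* On [0, pi] the sine is nonnegative, so its square determines it. *)
have sinE : rho t * sin (acos (u / rho t)) = t * B.
  have s0 : 0 <= rho t * sin (acos (u / rho t)).
    by rewrite mulr_ge0 ?(ltW rho0)// sin_ge0_pi// th0.
  apply/eqP; rewrite -(@eqrXn2 _ 2)//; last by rewrite mulr_ge0.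
  have := cos2Dsin2 (acos (u / rho t)) => /(congr1 (fun v => rho t ^+ 2 * v)).
  rewrite mulr1 mulrDr -!exprMn cosE {1}r2 => /addrI ->//.
rewrite zE; split=> //.
have zE' : zeta t = acos (u / rho t) / phi by rewrite -zE mulfK// gt_eqF.
rewrite zE' divr_ge0//= ?ler_pdivrMr// ?mul1r; last exact: ltW.
(* An angle beyond [phi] would make rho sin(angle - phi) positive, but this quantity equals - (1 -
   t) r0 sin phi. *)
rewrite leNgt; apply/negP => phith.
have : 0 < rho t * sin (acos (u / rho t) - phi).
  rewrite mulr_gt0// sin_gt0_pi// subr_gt0 phith/=.
  by rewrite ltrBlDr (le_lt_trans thpi)// ltrDl.
rewrite sinB mulrBr !mulrA cosE sinE.
have -> : t * B * cos phi - u * sin phi = - ((1 - t) * r0%:num * sin phi).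
  by rewrite uE /B; ring.
rewrite oppr_gt0 ltNge => /negP; apply.
by rewrite !mulr_ge0 ?subr_ge0// ltW.
Qed.

Lemma cgeod_zeta_gt0 t : 0 < ri%:num -> 0 < t <= 1 -> 0 < zeta t.
Proof.
move=> ri0 /andP[t0 t1].
have t01 : 0 <= t <= 1 by rewrite ltW.
have [_ h /andP[z0 _]] := cgeod_angle_polar
  (cgeod_radius_gt0 t01 (or_intror ri0)) t01.
rewrite lt_neqAle z0 andbT; apply/eqP => z0'; move: h.
rewrite -z0' mul0r sin0 mulr0 => /esym/eqP.
by rewrite !mulf_eq0 !gt_eqF.
Qed.

Lemma cgeod_zeta_surj s : 0 < ri%:num -> 0 < s <= 1 ->
  exists2 t, 0 < t <= 1 & zeta t = s.
Proof.
move=> ri0 /andP[s0 s1]; set th := s * phi.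
have th0 : 0 < th by rewrite mulr_gt0.
have thphi : th <= phi by rewrite ger_pMl.
have sth : 0 < sin th by rewrite sin_gt0_pi// th0 (le_lt_trans thphi).
have sth' : 0 <= sin (phi - th) by rewrite sin_ge0_pi//; have := phipi; lra.
have a0 : 0 < r0%:num * sin th by rewrite mulr_gt0.
have b0 : 0 <= ri%:num * sin (phi - th) by rewrite mulr_ge0.
(* The ray of angle [th] cuts the triangle spanned by the chord and the origin into two parts with
   areas in the ratio of the summands of [N]. This gives the parameter [t] of the intersection, and
   comparing with the whole area gives its radius [k]. *)
set N := r0%:num * sin th + ri%:num * sin (phi - th).
have N0 : 0 < N by rewrite ltr_wpDr.
exists (r0%:num * sin th / N).
  by rewrite divr_gt0// ler_pdivrMr// mul1r lerDl.
set t := _ / N.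
set k := r0%:num * ri%:num * sin phi / N.
have k0 : 0 < k by rewrite divr_gt0// !mulr_gt0.
have uE : r0%:num - t * A = k * cos th.
  rewrite /t /k /A; apply: (mulIf (lt0r_neq0 N0)); rewrite mulrBl.
  rewrite [X in _ - X]mulrAC divfK ?gt_eqF// [RHS]mulrAC divfK ?gt_eqF//.
  by rewrite /N sinB; ring.
have vE : t * B = k * sin th by rewrite /t /k /B; ring.
have rE : rho t = k.
  rewrite cgeod_radiusE uE vE; clearbody k; rewrite !exprMn -mulrDr cos2Dsin2 mulr1.
  by rewrite sqrtr_sqr gtr0_norm.
rewrite /zeta /cgeod_zeta -/phi rE.
have -> : (1 - t) * r0%:num + t * ri%:num * cos phi = k * cos th.
  by rewrite -uE /A; ring.
rewrite mulrC [k * _]mulrC mulfK ?gt_eqF// cosK ?mulfK ?gt_eqF//.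
by rewrite in_itv/= ltW//=; have := phipi; lra.
Qed.

Lemma cgeod_zeta_repar0 : 0 < ri%:num -> repar0 zeta.
Proof.
move=> ri0; have B0 : 0 < B by rewrite mulr_gt0.
split=> [e e0|d d0].
(* [a] is an angle of positive sine and at most [e * phi]; for small [t] the chord stays below the
   ray of angle [a]. *)
- pose a := Num.min (e * phi) (phi / 2).
  have a0 : 0 < a by rewrite lt_min mulr_gt0// divr_gt0.
  have ae : a <= e * phi by rewrite ge_min lexx.
  have aphi : a <= phi / 2 by rewrite ge_min lexx orbT.
  have sa : 0 < sin a by rewrite sin_gt0_pi//; have := phi0; have := phipi; lra.
  pose M := `|A| + B; have M0 : 0 < M by rewrite ltr_wpDl.
  exists (Num.min 1 (r0%:num * sin a / M)).
    by rewrite lt_min ltr01 divr_gt0// mulr_gt0.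
  move=> t /andP[t0]; rewrite lt_min ltr_pdivlMr// => /andP[t1 tM].
  have t01 : 0 <= t <= 1 by rewrite !ltW.
  have rho0 := cgeod_radius_gt0 t01 (or_intror ri0).
  have [h1 h2 /andP[z0 z1]] := cgeod_angle_polar rho0 t01.
  rewrite cgeod_zeta_gt0 ?t0 ?ltW//=.
  rewrite -(ltr_pM2r phi0); apply: lt_le_trans ae.
  have zphi : zeta t * phi <= phi by rewrite ger_pMl.
  (* An angle of at least [a] would give (r0 - t A) sin a <= t B cos a, against t (|A| + B) < r0 sin
     a. *)
  rewrite ltNge; apply/negP => az.
  have : 0 <= rho t * sin (zeta t * phi - a).
    by rewrite mulr_ge0 ?(ltW rho0)// sin_ge0_pi//; have := phipi; lra.
  rewrite sinB mulrBr !mulrA h1 h2 leNgt => /negP; apply.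
  have h3 : t * B * cos a <= t * B.
    by rewrite ler_piMr// ?cos_le1// mulr_ge0// ltW.
  have h4 : t * A * sin a <= t * `|A|.
    rewrite -mulrA ler_wpM2l ?(ltW t0)// (le_trans (ler_norm _))// normrM.
    by rewrite ler_piMr// sin_max.
  rewrite /M in tM; lra.
- pose M := (r0%:num + ri%:num) * phi.
  have M0 : 0 < M by rewrite mulr_gt0// addr_gt0.
  exists (Num.min 1 (d * B / M)); first by rewrite lt_min ltr01 divr_gt0// mulr_gt0.
  move=> s /andP[s0]; rewrite lt_min ltr_pdivlMr// => /andP[s1 sM].
  have [|t t01 ts] := @cgeod_zeta_surj s ri0; first by rewrite s0 ltW.
  exists t => //; have /andP[t0 t1] := t01; rewrite t0/=.
  have t01' : 0 <= t <= 1 by rewrite ltW.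
  have rho0 := cgeod_radius_gt0 t01' (or_intror ri0).
  have [_ h _] := cgeod_angle_polar rho0 t01'.
  (* The chain is t B = rho sin(s phi) <= (r0 + ri) s phi < d B. *)
  rewrite -(ltr_pM2r B0) -h ts; apply: le_lt_trans sM.
  rewrite mulrCA /M; apply: ler_pM.
  + exact: ltW.
  + have sphi : s * phi <= phi by rewrite ger_pMl// ltW.
    by rewrite sin_ge0_pi// mulr_ge0 ?(ltW s0) ?(ltW phi0)//= (le_trans sphi)// ltW.
  + exact: cgeod_radius_le.
  + by have /andP[] : s * phi * (1 - s * phi) <= sin (s * phi) <= s * phi
      by apply: sin_bounds; rewrite mulr_ge0 ?(ltW s0) ?(ltW phi0).
Qed.

End Chord.

(** * Distances and comparison cosines of the cone in polar coordinates *)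

Section ConeAngle.
Context {R : realType} {X : metricType R}.
Implicit Types (x y : X) (r : {nonneg R}).

Lemma mdist_cpt x y r s : mdist x y < pi ->
  mdist (cpt x r) (cpt y s) = Num.sqrt (r%:num ^+ 2 + s%:num ^+ 2
    - 2 * r%:num * s%:num * cos (mdist x y)).
Proof.
by move=> h; rewrite [LHS]cone_distE min_r// ltW.
Qed.

Lemma mdist_cptE x y r s : mdist x y < pi ->
  mdist (cpt x r) (cpt y s) =
  Num.sqrt ((r%:num - s%:num * cos (mdist x y)) ^+ 2
    + (s%:num * sin (mdist x y)) ^+ 2).
Proof.
move=> h; rewrite mdist_cpt//; congr Num.sqrt.
have sE : sin (mdist x y) ^+ 2 = 1 - cos (mdist x y) ^+ 2.
  by rewrite -(cos2Dsin2 (mdist x y)); ring.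
by rewrite [X in _ = _ + X]exprMn sE; ring.
Qed.

(** Unrolling preserves the distance to the starting point (r0, 0), from which the chord has moved
    by t (-A, B). *)
Lemma mdist_polar x y r rho A B t : mdist x y < pi -> 0 < t ->
  rho%:num * cos (mdist x y) = r%:num - t * A ->
  rho%:num * sin (mdist x y) = t * B ->
  mdist (cpt x r) (cpt y rho) = t * Num.sqrt (A ^+ 2 + B ^+ 2).
Proof.
move=> h t0 hc hs; rewrite mdist_cptE// hc hs.
have -> : (r%:num - (r%:num - t * A)) ^+ 2 + (t * B) ^+ 2 =
  t ^+ 2 * (A ^+ 2 + B ^+ 2) by ring.
by rewrite sqrtrM ?sqr_ge0// sqrtr_sqr gtr0_norm.
Qed.

(** Expanding the laws of cosines, the terms in [r0] combine to -2 (r0 - t1 A1) (r0 - t2 A2), which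
    is -2 rho1 rho2 times the product of the two cosines, and 2 t1 t2 A1 A2 remains. *)
Lemma a0_polar x0 r0 y1 y2 (rho1 rho2 : {nonneg R}) (A1 B1 A2 B2 t1 t2 : R) :
  0 < t1 -> 0 < t2 ->
  mdist x0 y1 < pi -> mdist x0 y2 < pi -> mdist y1 y2 < pi ->
  rho1%:num * cos (mdist x0 y1) = r0%:num - t1 * A1 ->
  rho1%:num * sin (mdist x0 y1) = t1 * B1 ->
  rho2%:num * cos (mdist x0 y2) = r0%:num - t2 * A2 ->
  rho2%:num * sin (mdist x0 y2) = t2 * B2 ->
  0 < A1 ^+ 2 + B1 ^+ 2 -> 0 < A2 ^+ 2 + B2 ^+ 2 ->
  a0 (cpt x0 r0) (cpt y1 rho1) (cpt y2 rho2) =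
  (A1 * A2 + rho1%:num * rho2%:num / (t1 * t2) *
     (cos (mdist y1 y2) - cos (mdist x0 y1) * cos (mdist x0 y2)))
  / (Num.sqrt (A1 ^+ 2 + B1 ^+ 2) * Num.sqrt (A2 ^+ 2 + B2 ^+ 2)).
Proof.
move=> t10 t20 h1 h2 h c1 s1 c2 s2 d10 d20.
rewrite /a0 (mdist_polar h1 t10 c1 s1) (mdist_polar h2 t20 c2 s2) mdist_cpt//.
have r0E y (rho : {nonneg R}) A B t : rho%:num * cos (mdist x0 y) = r0%:num - t * A ->
    rho%:num * sin (mdist x0 y) = t * B ->
    rho%:num ^+ 2 = (r0%:num - t * A) ^+ 2 + (t * B) ^+ 2.
  by move=> <- <-; rewrite !exprMn -mulrDr cos2Dsin2 mulr1.
have e1 := r0E _ _ _ _ _ c1 s1; have e2 := r0E _ _ _ _ _ c2 s2.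
have d1E := sqr_sqrtr (ltW d10); have d2E := sqr_sqrtr (ltW d20).
have d1n : Num.sqrt (A1 ^+ 2 + B1 ^+ 2) != 0 by rewrite gt_eqF// sqrtr_gt0.
have d2n : Num.sqrt (A2 ^+ 2 + B2 ^+ 2) != 0 by rewrite gt_eqF// sqrtr_gt0.
rewrite sqr_sqrtr; last first.
  rewrite subr_ge0; have p : 0 <= 2 * rho1%:num * rho2%:num by rewrite !mulr_ge0.
  have := ler_wpM2l p (cos_le1 (mdist y1 y2)).
  by have := sqr_ge0 (rho1%:num - rho2%:num); nra.
move: (Num.sqrt _) (Num.sqrt _) d1E d2E d1n d2n => d1 d2 d1E d2E d1n d2n.
rewrite e1 e2 !exprMn d1E d2E.
have cc : rho1%:num * rho2%:num * (cos (mdist x0 y1) * cos (mdist x0 y2)) =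
    (r0%:num - t1 * A1) * (r0%:num - t2 * A2) by rewrite -c1 -c2; ring.
rewrite [_ / (t1 * t2) * _]mulrAC mulrBr cc.
field.
by rewrite d1n d2n !gt_eqF.
Qed.

Section Geodesic.
Variables (x0 xi : X) (r0 ri : {nonneg R}) (x0i : R -> X).
Hypotheses (r0_gt0 : 0 < r0%:num) (hx : Geod x0 xi x0i).
Hypothesis zi : cpt xi ri <> cpt x0 r0.
Hypothesis phi_pi : mdist x0 xi < pi.

Lemma Geod_mdist0 s : 0 <= s <= 1 -> mdist x0 (x0i s) = s * mdist x0 xi.
Proof.
move=> s01; have [g0 _ h] := hx; have /andP[s0 _] := s01.
by rewrite -{1}g0 h ?lexx ?ler01// sub0r normrN ger0_norm.
Qed.

Lemma cgeod0 : cgeod x0 xi r0 ri x0i 0 = cpt x0 r0.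
Proof.
have [g0 _ _] := hx; rewrite /cgeod; case: eqVneq => [_|_].
  congr cpt; apply/val_inj => /=.
  by rewrite subr0 mul1r mul0r addr0 ger0_norm.
have rE : (cgeod_radius x0 xi r0 ri 0)%:num = r0%:num.
  rewrite /= subr0 expr1n mul1r expr0n mulr0 !mul0r !addr0.
  by rewrite sqrtr_sqr ger0_norm.
rewrite /cgeod_zeta rE subr0 mul1r !mul0r addr0 divff ?gt_eqF// acos1 mulr0 g0.
by congr cpt; apply/val_inj.
Qed.

Lemma cgeod_neq t : 0 < mdist x0 xi ->
  cgeod x0 xi r0 ri x0i t =
  cpt (x0i (cgeod_zeta x0 xi r0 ri t)) (cgeod_radius x0 xi r0 ri t).
Proof.
by move=> phi0; rewrite /cgeod; case: eqVneq phi0 => // ->; rewrite mdistxx ltxx.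
Qed.

(** Treats [x0 = xi], where the chord lies on the axis, together with the generic case; [t < 1]
    keeps the point off the apex. *)
Lemma cgeod_polar t : 0 < t < 1 -> exists y (rho : {nonneg R}),
  [/\ cgeod x0 xi r0 ri x0i t = cpt y rho, 0 < rho%:num,
      rho%:num * cos (mdist x0 y) =
        r0%:num - t * (r0%:num - ri%:num * cos (mdist x0 xi)),
      rho%:num * sin (mdist x0 y) = t * (ri%:num * sin (mdist x0 xi)) &
      mdist x0 y < pi].
Proof.
move=> /andP[t0 t1].
have := mdist_ge0 x0 xi; rewrite le_eqVlt => /predU1P[/esym phi0|phi0].
  have x0xi : x0 = xi by apply: mdist_positivity.
  rewrite /cgeod {1}x0xi eqxx; do 2 eexists; split; first by reflexivity.
  - rewrite /= gtr0_norm; first rewrite ltr_pwDl// ?mulr_ge0// ?(ltW t0)//.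
      by rewrite mulr_gt0// subr_gt0.
    by rewrite ltr_pwDl// ?mulr_ge0// ?(ltW t0)// mulr_gt0// subr_gt0.
  - rewrite -x0xi mdistxx cos0 /= ger0_norm; first by ring.
    by rewrite addr_ge0// mulr_ge0 ?subr_ge0// ltW.
  - by rewrite -x0xi mdistxx sin0 !mulr0.
  - by rewrite mdistxx pi_gt0.
have phib : 0 < mdist x0 xi < pi by rewrite phi0.
have t01 : 0 <= t <= 1 by rewrite !ltW.
have rho0 := cgeod_radius_gt0 (ri := ri) r0_gt0 phib t01 (or_introl t1).
have [h1 h2 z01] := cgeod_angle_polar phib rho0 t01.
rewrite (cgeod_neq _ phi0); do 2 eexists; split; first by reflexivity.
- exact: rho0.
- by rewrite Geod_mdist0.
- by rewrite Geod_mdist0.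
- rewrite Geod_mdist0// (le_lt_trans _ phi_pi)// ger_pMl//.
  by have /andP[] := z01.
Qed.

(** The sum is the squared distance in the cone between two distinct points. *)
Lemma chord_gt0 : 0 < (r0%:num - ri%:num * cos (mdist x0 xi)) ^+ 2
  + (ri%:num * sin (mdist x0 xi)) ^+ 2.
Proof.
rewrite -sqrtr_gt0 -mdist_cptE// lt_neqAle mdist_ge0 andbT eq_sym.
by apply/eqP => /mdist_positivity h; apply: zi.
Qed.

End Geodesic.

(** * Comparison cosines along two cone geodesics *)

Section TwoGeodesics.
Variables (x0 x1 x2 : X) (r0 r1 r2 : {nonneg R}) (x01 x02 : R -> X).
Hypotheses (r0_gt0 : 0 < r0%:num).
Hypotheses (hz1 : cpt x1 r1 <> cpt x0 r0) (hz2 : cpt x2 r2 <> cpt x0 r0).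
Hypotheses (hx01 : Geod x0 x1 x01) (hx02 : Geod x0 x2 x02).
Let phi1 : R := mdist x0 x1.
Let phi2 : R := mdist x0 x2.
Hypotheses (phi1_pi : phi1 < pi) (phi2_pi : phi2 < pi).
Let z01 := cgeod x0 x1 r0 r1 x01.
Let z02 := cgeod x0 x2 r0 r2 x02.
Let dd := mdist (cpt x0 r0) (cpt x1 r1) * mdist (cpt x0 r0) (cpt x2 r2).
Let P : R := (r0%:num - r1%:num * cos phi1) * (r0%:num - r2%:num * cos phi2).
Let Q : R := r1%:num * r2%:num * sin phi1 * sin phi2.

Lemma mdist_cpt_prod_gt0 : 0 < dd.
Proof. by rewrite /dd !mdist_cptE// mulr_gt0// sqrtr_gt0 chord_gt0. Qed.

(* When a chord is radial, one of the two points of X is x0 and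
   [cos d - cos a * cos b] vanishes. *)
Lemma a0_cgeod_radial : Q = 0 -> forall s t, 0 < s < 1 -> 0 < t < 1 ->
  a0 (z01 0) (z01 s) (z02 t) = P / dd.
Proof.
move=> Q0 s t s01 t01; rewrite /z01 /z02 cgeod0//.
have [y1 [rho1 [-> rho10 c1 s1 y1pi]]] := cgeod_polar r1 r0_gt0 hx01 phi1_pi s01.
have [y2 [rho2 [-> rho20 c2 s2 y2pi]]] := cgeod_polar r2 r0_gt0 hx02 phi2_pi t01.
have [/andP[s0 _] /andP[t0 _]] := (s01, t01).
have eqx0 y (rho : {nonneg R}) : 0 < rho%:num ->
    rho%:num * sin (mdist x0 y) = 0 -> mdist x0 y < pi -> x0 = y.
  move=> rho0 /eqP; rewrite mulf_eq0 gt_eqF//= => /eqP sy ypi.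
  apply: mdist_positivity; apply/eqP; rewrite eq_le mdist_ge0 andbT leNgt.
  by apply/negP => y0; have := @sin_gt0_pi R (mdist x0 y); rewrite y0 ypi sy ltxx
    => /(_ isT).
have : x0 = y1 \/ x0 = y2.
  have : (r1%:num * sin phi1) * (r2%:num * sin phi2) = 0 by rewrite -Q0 /Q; ring.
  move=> /eqP; rewrite mulf_eq0 => /orP[|] /eqP B0; [left|right].
    by apply: (eqx0 _ rho1) => //; rewrite s1 B0 mulr0.
  by apply: (eqx0 _ rho2) => //; rewrite s2 B0 mulr0.
move=> y12; have [ypi yE] : mdist y1 y2 < pi /\
    cos (mdist y1 y2) = cos (mdist x0 y1) * cos (mdist x0 y2).
  case: y12 => <-; first by rewrite mdistxx cos0 mul1r.
  by rewrite mdistxx cos0 mulr1 metric_sym.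
rewrite (a0_polar s0 t0 y1pi y2pi ypi c1 s1 c2 s2) ?chord_gt0//.
by rewrite yE subrr mulr0 addr0 /dd !mdist_cptE.
Qed.

(** Provides the approximation hypothesis of the change of parameter, with constants [P / dd] and
    [Q / dd]: after the exact identity, the only error is that between the spherical and the
    Euclidean angle. *)
Lemma a0_cgeod_near : 0 < phi1 -> 0 < phi2 -> 0 < r1%:num -> 0 < r2%:num ->
  forall e, 0 < e -> exists2 d, 0 < d &
  forall s t, 0 < s < d -> 0 < t < d ->
    `|a0 (z01 0) (z01 s) (z02 t) - (P / dd + Q / dd *
       a0 (x01 0) (x01 (cgeod_zeta x0 x1 r0 r1 s))
         (x02 (cgeod_zeta x0 x2 r0 r2 t)))| < e.
Proof.
move=> phi10 phi20 r10 r20 e e0.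
have phi1b : 0 < phi1 < pi by rewrite phi10.
have phi2b : 0 < phi2 < pi by rewrite phi20.
have Q0 : 0 < Q by rewrite /Q !mulr_gt0// sin_gt0_pi.
have dd0 := mdist_cpt_prod_gt0.
(* The bound 1/4 admits the comparison of angles; the other makes its error [8 * e'], scaled by
   [Q / dd], at most e / 2. *)
pose e' := Num.min 4^-1 (e / 16 / (Q / dd)).
have e'0 : 0 < e' by rewrite lt_min invr_gt0 ltr0n !divr_gt0.
have e'4 : e' <= 4^-1 by rewrite ge_min lexx.
have e'Q : Q / dd * (8 * e') < e.
  have : e' <= e / 16 / (Q / dd) by rewrite ge_min lexx orbT.
  by rewrite ler_pdivlMr ?divr_gt0//; lra.
have e1 : 0 < e' / 2 / phi1 by rewrite !divr_gt0.
have e2 : 0 < e' / 2 / phi2 by rewrite !divr_gt0.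
have [d1 d10 h1] := (cgeod_zeta_repar0 r0_gt0 phi1b r10).1 _ e1.
have [d2 d20 h2] := (cgeod_zeta_repar0 r0_gt0 phi2b r20).1 _ e2.
exists (Num.min 1 (Num.min d1 d2)) => [|s t]; first by rewrite !lt_min ltr01 d10.
rewrite !lt_min => /and4P[s0 s1 sd1 _] /and4P[t0 t1 _ td2].
have /andP[] := h1 s (introT andP (conj s0 sd1)).
have /andP[] := h2 t (introT andP (conj t0 td2)).
rewrite !ltr_pdivlMr//; set z1 := cgeod_zeta _ _ _ _ s; set z2 := cgeod_zeta _ _ _ _ t.
move=> z20 z2e z10 z1e.
have s01 : 0 <= s <= 1 by rewrite !ltW.
have t01 : 0 <= t <= 1 by rewrite !ltW.
have rho10 := cgeod_radius_gt0 (ri := r1) r0_gt0 phi1b s01 (or_introl s1).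
have [c1 sn1 z1b] := cgeod_angle_polar phi1b rho10 s01.
have rho20 := cgeod_radius_gt0 (ri := r2) r0_gt0 phi2b t01 (or_introl t1).
have [c2 sn2 z2b] := cgeod_angle_polar phi2b rho20 t01.
have [x010 _ _] := hx01.
rewrite /z01 cgeod0// x010 cgeod_neq// /z02 cgeod_neq// -/z1 -/z2.
set y1 := x01 z1; set y2 := x02 z2.
have a1E : mdist x0 y1 = z1 * phi1 by apply: Geod_mdist0.
have a2E : mdist x0 y2 = z2 * phi2 by apply: Geod_mdist0.
rewrite -/z1 -a1E in c1 sn1; rewrite -/z2 -a2E in c2 sn2.
rewrite -a1E in z1e; rewrite -a2E in z2e.
have a10 : 0 < mdist x0 y1 by rewrite a1E mulr_gt0.
have a20 : 0 < mdist x0 y2 by rewrite a2E mulr_gt0.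
have tri1 := metric_triangle x0 y1 y2; have tri2 := metric_triangle y1 x0 y2.
have := metric_triangle x0 y2 y1; rewrite (metric_sym y2) => tri3.
rewrite (metric_sym y1 x0) in tri2.
(* Two sides are below 1/8, so all three distances are below pi and the truncation in the cone
   metric is inactive. *)
have pi2 := @pi_ge2 R.
have a1pi : mdist x0 y1 < pi by lra.
have a2pi : mdist x0 y2 < pi by lra.
have ypi : mdist y1 y2 < pi by lra.
rewrite (a0_polar s0 t0 a1pi a2pi ypi c1 sn1 c2 sn2) ?chord_gt0//.
rewrite -!mdist_cptE// -/dd -/phi1 -/phi2 -/P.
have sin1 : 0 < sin (mdist x0 y1) by rewrite sin_gt0_pi// a10.
have sin2 : 0 < sin (mdist x0 y2) by rewrite sin_gt0_pi// a20.
set C := cos (mdist y1 y2) - _.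
(* The relation rho sin(angle) = t B eliminates the radii and leaves the spherical comparison
   cosine. *)
have -> : (P + (cgeod_radius x0 x1 r0 r1 s)%:num
    * (cgeod_radius x0 x2 r0 r2 t)%:num / (s * t) * C) / dd
    - (P / dd + Q / dd * a0 x0 y1 y2) =
  Q / dd * (C / (sin (mdist x0 y1) * sin (mdist x0 y2)) - a0 x0 y1 y2).
  have -> : (cgeod_radius x0 x1 r0 r1 s)%:num =
      s * (r1%:num * sin phi1) / sin (mdist x0 y1) by rewrite -sn1 mulfK// gt_eqF.
  have -> : (cgeod_radius x0 x2 r0 r2 t)%:num =
      t * (r2%:num * sin phi2) / sin (mdist x0 y2) by rewrite -sn2 mulfK// gt_eqF.
  by rewrite /Q; field; rewrite !gt_eqF.
have Qdd : 0 < Q / dd by rewrite divr_gt0.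
rewrite normrM (gtr0_norm Qdd); apply: le_lt_trans e'Q.
rewrite ler_pM2l//; apply: spherical_euclidean_angle => //; last by lra.
by rewrite ler_norml tri2 andbT; apply/andP; split; lra.
Qed.

End TwoGeodesics.
End ConeAngle.

(** * Limit points and upper angles in the cone, by cases on whether a chord is radial *)

Theorem proposition2p20 (R : realType) (X : metricType R)
    (hX : geodesic_space X)
    (x0 x1 x2 : X) (r0 r1 r2 : {nonneg R}) (x01 x02 : R -> X)
    (hz0 : ~ is_apex (cpt x0 r0))
    (hz1 : cpt x1 r1 <> cpt x0 r0) (hz2 : cpt x2 r2 <> cpt x0 r0)
    (hx01 : Geod x0 x1 x01) (hx02 : Geod x0 x2 x02) :
  let phi01 : R := mdist x0 x1 in
  let phi02 : R := mdist x0 x2 in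
  let z01 : R -> cone X := cgeod x0 x1 r0 r1 x01 in
  let z02 : R -> cone X := cgeod x0 x2 r0 r2 x02 in
  let d01 : R := mdist (cpt x0 r0) (cpt x1 r1) in
  let d02 : R := mdist (cpt x0 r0) (cpt x2 r2) in
  let P : R := (r0%:num - r1%:num * cos phi01)
                * (r0%:num - r2%:num * cos phi02) in
  let Q : R := r1%:num * r2%:num * sin phi01 * sin phi02 in
  (0 < phi01 < pi -> 0 < phi02 < pi ->
     [/\ AP z01 z02 = [set P / (d01 * d02) + Q / (d01 * d02) * c
                        | c in AP x01 x02],
         cos (angle_up z01 z02) =
           (P + Q * cos (angle_up x01 x02)) / (d01 * d02) &
         (0 < r1%:num -> 0 < r2%:num ->
          cos (angle_up x01 x02) =
            d01 * d02 * cos (angle_up z01 z02) / Q - P / Q)])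
  /\
  (x0 = x1 \/ x0 = x2 -> phi01 < pi -> phi02 < pi ->
     cos (angle_up z01 z02) = P / (d01 * d02)).
Proof.
move=> phi01 phi02 z01 z02 d01 d02 P Q.
have r0_gt0 : 0 < r0%:num.
  rewrite lt_neqAle eq_sym; apply/andP; split=> //; apply/eqP => r00.
  by apply: hz0; exists x0; congr cpt; apply/val_inj.
have radial : Q = 0 -> phi01 < pi -> phi02 < pi -> exists2 d, 0 < d &
    forall s t, 0 < s < d -> 0 < t < d -> a0 (z01 0) (z01 s) (z02 t) = P / (d01 * d02).
  move=> Q0 phi1 phi2; exists 1 => // s t s1 t1.
  exact: (a0_cgeod_radial r0_gt0 hz1 hz2 hx01 hx02 phi1 phi2 Q0 s1 t1).
have radial_angle : Q = 0 -> phi01 < pi -> phi02 < pi ->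
    cos (angle_up z01 z02) = P / (d01 * d02).
  move=> Q0 phi1 phi2; apply: (liminf0_unique (cos_angle_up_liminf0 _ _)).
  by apply: liminf0_cst; apply: radial.
split; last first.
  move=> x0i phi1 phi2; apply: radial_angle => //; rewrite /Q.
  by case: x0i => x0i; rewrite /phi01 /phi02 -x0i mdistxx sin0 ?(mulr0, mul0r).
move=> phi1b phi2b.
have [[phi10 phi1] [phi20 phi2]] := (andP phi1b, andP phi2b).
have dd0 : 0 < d01 * d02 := mdist_cpt_prod_gt0 hz1 hz2 phi1 phi2.
(* Both sines being positive, [Q = 0] means that [r1] or [r2] vanishes; the comparison cosine is
   then constant near 0. *)
have [Q0|Qn0] := eqVneq Q 0.
  split; last 1 first.
  - move=> r10 r20; have : 0 < Q by rewrite /Q !mulr_gt0// sin_gt0_pi.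
    by rewrite Q0 ltxx.
  - apply/seteqP; split=> [c /APP cl|_ [c _ <-]].
      have [c' c'AP] := AP_neq0 x01 x02; exists c' => //.
      by rewrite Q0 !mul0r addr0 (cluster0_cst (radial Q0 phi1 phi2) cl).
    rewrite Q0 !mul0r addr0; apply/APP/liminf0_cluster/liminf0_cst.
    exact: radial.
  - by rewrite Q0 mul0r addr0 radial_angle.
have [r10 r20] : 0 < r1%:num /\ 0 < r2%:num.
  move: Qn0; rewrite /Q !mulf_eq0 !negb_or => /andP[/andP[/andP[r1n r2n] _] _].
  by rewrite !lt_def r1n r2n !ge0.
have Q0 : 0 < Q by rewrite /Q !mulr_gt0// sin_gt0_pi.
have Qdd : 0 < Q / (d01 * d02) by rewrite divr_gt0.
have near := a0_cgeod_near r0_gt0 hz1 hz2 hx01 hx02 phi1 phi2 phi10 phi20 r10 r20.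
have rp1 := cgeod_zeta_repar0 r0_gt0 phi1b r10.
have rp2 := cgeod_zeta_repar0 r0_gt0 phi2b r20.
have angleE : cos (angle_up z01 z02) =
    (P + Q * cos (angle_up x01 x02)) / (d01 * d02).
  rewrite mulrDl [Q * _ / _]mulrAC; apply: (liminf0_unique (cos_angle_up_liminf0 _ _)).
  exact: (liminf0_repar Qdd near rp1 rp2 (cos_angle_up_liminf0 x01 x02)).
split=> [|//|_ _]; last first.
  rewrite angleE [d01 * d02 * _]mulrC divfK ?gt_eqF// -mulrBl [P + _]addrC addrK.
  by rewrite [Q * _]mulrC mulfK ?gt_eqF.
apply/seteqP; split=> [c /APP cl|_ [c /APP cl <-]].
  (* The preimage of [c] under the affine map, which is invertible as [Q > 0]. *)
  exists ((c - P / (d01 * d02)) / (Q / (d01 * d02))).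
    by apply/APP; exact: (cluster0_repar_inv Qdd near rp1 rp2 cl).
  by rewrite [Q / _ * _]mulrC divfK ?gt_eqF// addrC subrK.
by apply/APP; exact: (cluster0_repar Qdd near rp1 rp2 cl).
Qed.
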